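(* Let $\Psi$ be an index function such that $$J(x^\dagger)-J(x_\alpha)\le \Psi(\alpha)\quad\text{for all }\alpha>0. \qquad ( * )$$ Then the following holds. Either $J(x^\dagger)=\min_{x\in X}J(x)$, and then $J(x_\alpha)=J(x^\dagger)$ for each $\alpha>0$ and every index function is a valid bound in $( * )$ in place of $\Psi$; or $J(x^\dagger)>\min_{x\in X}J(x)$, and then $\Psi$ increases near zero at most linearly (that is, $\Psi$ does not tend to zero super-linearly: there is no sequence $\alpha_k\downarrow0$ with $\Psi(\alpha_k)/\alpha_k\to0$).
   Context: Setting. $X$ is an infinite-dimensional Banach space, $H$ an infinite-dimensional Hilbert space with norm $\|\cdot\|$, and $A:X\to H$ a bounded linear operator with non-closed range. $J:X\to[0,\infty]$ is a proper convex functional, lower semi-continuous with respect to weak (or weak$^*$) sequential convergence, such that for every $c\ge0$ the sublevel set $\{x\in X: J(x)\le c\}$ is weakly (or weak$^*$) sequentially compact. $y\in \mathrm{range}(A)$, and $Ax=y$ has at least one solution with finite penalty value. $x^\dagger\in X$ denotes a $J$-minimizing solution: $Ax^\dagger=y$ and $J(x^\dagger)=\min\{J(x): x\in X, Ax=y\}<\infty$. Tikhonov functional: for $\alpha>0$ and $v\in H$, $T_\alpha(x;v):=\frac12\|Ax-v\|^2+\alpha J(x)$, $x\in X$. For each $\alpha>0$, $x_\alpha$ is an (arbitrarily selected) minimizer of $T_\alpha(\cdot;y)$ over $X$. An index function is a function $\varphi:(0,\infty)\to(0,\infty)$ that is continuous, strictly increasing and satisfies $\lim_{t\to+0}\varphi(t)=0$.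 *)

(* Defs.v *)
From HB Require Import structures.
From mathcomp Require Import all_boot all_order all_algebra.
From mathcomp Require Import all_classical all_reals all_analysis.
From mathcomp Require Import sesquilinear.
Set Implicit Arguments.
Unset Strict Implicit.
Unset Printing Implicit Defensive.
Import Order.TTheory GRing.Theory Num.Theory.
Import numFieldNormedType.Exports.
Local Open Scope classical_set_scope.
Local Open Scope ring_scope.

(* No finite family of vectors spans V. *)
Definition infinite_dimensional (R : realType) (V : lmodType R) : Prop :=
  forall (n : nat) (v : 'I_n -> V),
    exists x : V, forall c : 'I_n -> R, x <> \sum_(i < n) c i *: v i.

Definition bounded_operator (R : realType) (X Y : normedModType R)
    (A : X -> Y) : Prop :=
  exists M : R, forall x : X, `|A x| <= M * `|x|.

Definition weak_cvg (R : realType) (X : normedModType R)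
    (u : nat -> X) (x : X) : Prop :=
  forall f : {linear X -> R^o}, continuous f -> f (u n) @[n --> \oo] --> f x.

(* The pairing b identifies X isometrically with the topological dual of Z,
   through x |-> b x.  The supremum is finite because b x is continuous. *)
Definition is_dual_pairing (R : realType) (X Z : normedModType R)
    (b : {bilinear X -> Z -> R^o}) : Prop :=
  [/\ forall x : X, continuous (b x),
      forall x : X, `|x| = sup [set `|b x z| | z in [set z : Z | `|z| <= 1]]
    & forall f : {linear Z -> R^o}, continuous f -> exists x : X, b x =1 f].

Definition weakstar_cvg (R : realType) (X Z : normedModType R)
    (b : {bilinear X -> Z -> R^o}) (u : nat -> X) (x : X) : Prop :=
  forall z : Z, b (u n) z @[n --> \oo] --> b x z.

(* cvg_to is either weak sequential convergence on X or, for some predual Z of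
   X, weak-star sequential convergence on X = Z^*. *)
Definition weak_or_weakstar (R : realType) (X : normedModType R)
    (cvg_to : (nat -> X) -> X -> Prop) : Prop :=
  (forall u x, cvg_to u x <-> weak_cvg u x) \/
  (exists (Z : normedModType R) (b : {bilinear X -> Z -> R^o}),
      is_dual_pairing b /\ forall u x, cvg_to u x <-> weakstar_cvg b u x).

Section functionals.
Variables (R : realType) (X : lmodType R).
Local Open Scope ereal_scope.
Implicit Types (J : X -> \bar R) (cvg_to : (nat -> X) -> X -> Prop).

(* For nonnegative J, so that J never takes the value -oo. *)
Definition proper_functional J : Prop := exists x : X, J x < +oo.

Definition convex_functional J : Prop :=
  forall (x z : X) (t : R), (0 <= t <= 1)%R ->
    J (t *: x + (1 - t) *: z)%R <= t%:E * J x + (1 - t)%:E * J z.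

Definition seq_lower_semicontinuous cvg_to J : Prop :=
  forall (u : nat -> X) (x : X), cvg_to u x -> J x <= limn_einf (J \o u).

Definition seq_compact cvg_to (S : set X) : Prop :=
  forall u : nat -> X, (forall n, S (u n)) ->
    exists (x : X) (k : nat -> nat),
      [/\ S x, increasing_seq k & cvg_to (u \o k) x].

Definition is_argmin (D : set X) (f : X -> \bar R) (x : X) : Prop :=
  D x /\ forall z, D z -> f x <= f z.

End functionals.

Definition tikhonov (R : realType) (X : lmodType R) (H : normedModType R)
    (A : X -> H) (J : X -> \bar R) (alpha : R) (v : H) (x : X) : \bar R :=
  ((2^-1 * `|A x - v| ^+ 2)%:E + alpha%:E * J x)%E.

(* Only the values of phi on ]0, +oo[ are constrained. *)
Definition index_function (R : realType) (phi : R -> R) : Prop :=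
  [/\ forall t : R, 0 < t -> 0 < phi t,
      forall t : R, 0 < t -> {for t, continuous phi},
      forall s t : R, 0 < s -> s < t -> phi s < phi t
    & phi t @[t --> 0^'+] --> (0 : R)].

(* This is an inequality in \bar R: J (xa alpha) may a priori
   be +oo. *)
Definition penalty_bound (R : realType) (X : lmodType R) (J : X -> \bar R)
    (xdag : X) (xa : R -> X) (phi : R -> R) : Prop :=
  forall alpha : R, 0 < alpha ->
    (J xdag - J (xa alpha) <= (phi alpha)%:E)%E.

(* phi tends to zero super-linearly along some sequence decreasing to 0. *)
Definition superlinear_at_zero (R : realType) (phi : R -> R) : Prop :=
  exists a : nat -> R,
    [/\ forall k, 0 < a k, nonincreasing_seq a, a @ \oo --> (0 : R)
      & phi (a k) / a k @[k --> \oo] --> (0 : R)].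

(* Main.v *)
Require Import Defs.
From HB Require Import structures.
From mathcomp Require Import all_boot all_order all_algebra.
From mathcomp Require Import all_classical all_reals all_analysis.
From mathcomp Require Import sesquilinear.
From mathcomp Require Import ring lra.
Set Implicit Arguments.
Unset Strict Implicit.
Unset Printing Implicit Defensive.
Import Order.TTheory GRing.Theory Num.Theory.
Import numFieldNormedType.Exports.
Local Open Scope classical_set_scope.
Local Open Scope ring_scope.

(* With m a minimizer of J and r, s the residual norms of x_alpha and m,
   comparing the Tikhonov values at x_alpha and on the segment towards m gives,
   to first order, alpha (J x_alpha - J m) <= r s; only convexity of the norm is
   used.  Comparing with xdag gives r^2 <= 2 alpha Psi alpha.  Hence
     (J xdag - J m - Psi alpha)^2 <= 2 s^2 (Psi alpha / alpha),
   and a superlinear Psi would force J xdag <= J m. *)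

Lemma increasing_seq_cvg_pinfty (k : nat -> nat) :
  increasing_seq k -> k @ \oo --> \oo.
Proof.
move=> k_incr.
have k_ge n : (n <= k n)%N.
  elim: n => // n IHn; apply: leq_ltn_trans IHn _.
  by move/increasing_seqP: k_incr => /(_ n).
move=> S [N _ NS]; exists N => // n /= Nn.
exact/NS/(leq_trans Nn (k_ge n)).
Qed.

(** Direct method: a minimizing sequence within one sublevel set of finite level has a convergent
    subsequence, and lower semicontinuity bounds [J] at its limit by the infimum over that set. *)
Lemma exists_argmin (R : realType) (X : lmodType R)
    (cvg_to : (nat -> X) -> X -> Prop) (J : X -> \bar R) :
  (forall x, (0 <= J x)%E) -> proper_functional J ->
  seq_lower_semicontinuous cvg_to J ->
  (forall c : R, 0 <= c -> seq_compact cvg_to [set x | (J x <= c%:E)%E]) ->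
  exists m : X, is_argmin setT J m.
Proof.
move=> J_ge0 [x0 J0_lty] J_lsc J_compact.
have J0E : (fine (J x0))%:E = J x0 by rewrite fineK// ge0_fin_numE.
pose D := [set x | (J x <= (fine (J x0))%:E)%E].
have /ereal_inf_seq[v vD v_cvg] : J @` D != set0.
  by apply/set0P; exists (J x0), x0; rewrite // /D /= J0E.
have {vD} /choice[u uP] : forall n, exists x, D x /\ J x = v n.
  by move=> n; have [x Dx xv] := vD n; exists x.
have [|m [k [Dm k_incr ukm]]] := J_compact (fine (J x0)) _ u (fun n => (uP n).1).
  exact: fine_ge0.
have Jm_le : (J m <= ereal_inf (J @` D))%E.
  apply: le_trans (J_lsc _ _ ukm) _.
  have -> : J \o (u \o k) = v \o k by apply/funext => n /=; rewrite (uP _).2.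
  have vk := cvg_comp _ _ (increasing_seq_cvg_pinfty k_incr) v_cvg.
  by rewrite (cvg_limn_einf_sup vk).1.
(* Outside [D], the value of [J] exceeds the level of [D], hence also [J m], since [m] lies in
   [D]. *)
exists m; split => // z _; have [Dz|] := boolP (J z <= (fine (J x0))%:E)%E.
  by apply: le_trans Jm_le _; apply: ereal_inf_lbound; exists z.
by rewrite -ltNge => /ltW; apply: le_trans.
Qed.

Section tikhonov_minimizer.
Variables (R : realType) (X : lmodType R) (H : normedModType R).
Variables (A : {linear X -> H}) (J : X -> \bar R) (v : H).
Variables (alpha : R) (x : X).
Hypotheses (alpha_gt0 : 0 < alpha)
  (x_min : is_argmin setT (tikhonov A J alpha v) x).

(** The exact solution [z] has zero residual, so its Tikhonov value is [alpha * jz]; minimality at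
    [x] then also rules out [J x = +oo]. *)
Lemma tikhonov_residual (z : X) (jz : R) : (0 <= J x)%E ->
  A z = v -> J z = jz%:E ->
  exists jx : R, J x = jx%:E /\
    2^-1 * `|A x - v| ^+ 2 + alpha * jx <= alpha * jz.
Proof.
move=> Jx_ge0 Az Jz; have := x_min.2 z I.
rewrite /tikhonov Az subrr normr0 expr0n /= mulr0 add0e Jz.
case: (J x) Jx_ge0 => [jx _||//]; last by rewrite mulry gtr0_sg// mul1e.
by rewrite -!EFinM -EFinD lee_fin => le_xz; exists jx.
Qed.

(** Minimality of [x] is tested against [t *: z + (1 - t) *: x]; dividing by [t] and letting [t]
    tend to 0 leaves the first-order inequality. *)
Lemma tikhonov_optimality (z : X) (jx jz : R) : convex_functional J ->
  J x = jx%:E -> J z = jz%:E ->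
  alpha * (jx - jz) <= `|A x - v| * `|A z - v|.
Proof.
move=> J_convex Jx Jz; set r := `|A x - v|; set s := `|A z - v|.
have [r_ge0 s_ge0] : 0 <= r /\ 0 <= s by rewrite !normr_ge0.
have step t : 0 < t -> t <= 1 ->
    alpha * (jx - jz) <= r * s + t * (2^-1 * (s - r) ^+ 2).
  move=> t_gt0 t_le1; pose w := t *: z + (1 - t) *: x.
  have Jw : (J w <= (t * jz + (1 - t) * jx)%:E)%E.
    by rewrite EFinD !EFinM -Jx -Jz; apply: J_convex; rewrite (ltW t_gt0).
  have Aw : `|A w - v| <= t * s + (1 - t) * r.
    have -> : A w - v = t *: (A z - v) + (1 - t) *: (A x - v).
      rewrite /w linearD !linearZ /= !scalerBr addrACA -opprD -scalerDl.
      by rewrite [t + _]addrC subrK scale1r.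
    apply: le_trans (ler_normD _ _) _; rewrite !normrZ -/r -/s.
    by rewrite (ger0_norm (ltW t_gt0)) ger0_norm ?subr_ge0.
  have le_xw : 2^-1 * r ^+ 2 + alpha * jx
      <= 2^-1 * (t * s + (1 - t) * r) ^+ 2 + alpha * (t * jz + (1 - t) * jx).
    rewrite -lee_fin !EFinD (EFinM alpha) -Jx.
    apply: le_trans (x_min.2 w I) _; apply: leeD.
      by rewrite lee_fin ler_pM2l ?invr_gt0// lerXn2r ?nnegrE// (le_trans _ Aw).
    by rewrite EFinM; apply: lee_wpmul2l => //; rewrite lee_fin ltW.
  (* Expanding the square leaves the first-order term [t * r * (s - r)], whose part [- t * r ^+ 2]
     is discarded. *)
  have : t * (alpha * (jx - jz)) <= t * (r * s + t * (2^-1 * (s - r) ^+ 2)).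
    have : 0 <= t * r ^+ 2 by rewrite mulr_ge0 ?sqr_ge0// ltW.
    by move: le_xw; lra.
  by rewrite ler_pM2l.
set c := 2^-1 * (s - r) ^+ 2 in step.
have c_ge0 : 0 <= c by rewrite mulr_ge0 ?sqr_ge0.
(* This [t] makes the remainder [t * c] at most [e]; the shift to [c + 1] covers [c = 0]. *)
apply/ler_addgt0Pr => e e_gt0; pose t := Num.min 1 (e / (c + 1)).
have c1_gt0 : 0 < c + 1 by rewrite ltr_wpDl.
have t_gt0 : 0 < t by rewrite lt_min ltr01 divr_gt0.
apply: le_trans (step t t_gt0 _) _; first by rewrite ge_min lexx.
have : t * (c + 1) <= e by rewrite -ler_pdivlMr// ge_min lexx orbT.
lra.
Qed.

End tikhonov_minimizer.

(** Far along the sequence both [a k < 1] and [phi (a k) < e * a k] hold, so a single point can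
    replace the limit. *)
Lemma superlinear_small (R : realType) (phi : R -> R) (e : R) :
  superlinear_at_zero phi -> 0 < e ->
  exists a : R, [/\ 0 < a, phi a < e & phi a < e * a].
Proof.
move=> [a [a_gt0 _ a_cvg phia_cvg]] e_gt0.
have a_lt : \forall k \near \oo, a k < 1.
  by apply: cvgr_lt a_cvg _ _; rewrite ltr01.
have phia_lt : \forall k \near \oo, phi (a k) / a k < e.
  exact: cvgr_lt phia_cvg _ e_gt0.
have [k [ak_lt1 phiak]] := filter_ex (filterI a_lt phia_lt).
move: phiak; rewrite ltr_pdivrMr// => phiak.
exists (a k); split => //; apply: lt_trans phiak _.
by rewrite gtr_pMr.
Qed.

Theorem proposition2 (R : realType)
  (X : completeNormedModType R) (X_infdim : infinite_dimensional X)
  (H : completeNormedModType R) (H_infdim : infinite_dimensional H)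
  (dot : {dot H for idfun}) (H_norm : forall h : H, dot h h = `|h| ^+ 2)
  (A : {linear X -> H}) (A_bounded : bounded_operator A)
  (A_range : ~ closed (range A))
  (cvg_to : (nat -> X) -> X -> Prop) (cvg_toP : weak_or_weakstar cvg_to)
  (J : X -> \bar R) (J_ge0 : forall x, (0 <= J x)%E)
  (J_proper : proper_functional J) (J_convex : convex_functional J)
  (J_lsc : seq_lower_semicontinuous cvg_to J)
  (J_compact : forall c : R, 0 <= c ->
     seq_compact cvg_to [set x | (J x <= c%:E)%E])
  (y : H) (y_range : range A y)
  (y_finite : exists x : X, A x = y /\ (J x < +oo)%E)
  (xdag : X) (xdag_min : is_argmin [set x | A x = y] J xdag)
  (xdag_finite : (J xdag < +oo)%E)
  (xa : R -> X)
  (xa_min : forall alpha : R, 0 < alpha ->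
     is_argmin setT (tikhonov A J alpha y) (xa alpha))
  (Psi : R -> R) (Psi_index : index_function Psi)
  (Psi_bound : penalty_bound J xdag xa Psi) :
  [/\ is_argmin setT J xdag,
      forall alpha : R, 0 < alpha -> J (xa alpha) = J xdag
    & forall Phi : R -> R, index_function Phi -> penalty_bound J xdag xa Phi]
  \/
  ((exists m : X, is_argmin setT J m /\ (J m < J xdag)%E) /\
   ~ superlinear_at_zero Psi).
Proof.
have Jfin x : (J x < +oo)%E -> exists j : R, J x = j%:E.
  by move: (J_ge0 x); case: (J x) => // j; exists j.
have [Adag dag_min] := xdag_min; rewrite /= in Adag.
have [jd Jd] := Jfin _ xdag_finite.
have residual (alpha : R) (alpha_gt0 : 0 < alpha) :=
  tikhonov_residual alpha_gt0 (xa_min _ alpha_gt0) (J_ge0 _) Adag Jd.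
have [m m_min] := exists_argmin J_ge0 J_proper J_lsc J_compact.
have [Jdm|Jmd] := leP (J xdag) (J m).
  left.
  have d_min : is_argmin setT J xdag.
    by split => // z _; apply: le_trans Jdm (m_min.2 z I).
  have Ja alpha : 0 < alpha -> J (xa alpha) = J xdag.
    move=> alpha_gt0; apply/eqP; rewrite eq_le (d_min.2 _ I) andbT.
    (* Dropping the squared residual leaves [alpha * j <= alpha * jd]. *)
    have [j [-> le_jd]] := residual _ alpha_gt0.
    rewrite Jd lee_fin -(ler_pM2l alpha_gt0); apply: le_trans le_jd.
    by rewrite lerDr mulr_ge0 ?sqr_ge0.
  split => // Phi [Phi_gt0 _ _ _] alpha alpha_gt0.
  by rewrite Ja// Jd -EFinB subrr lee_fin ltW ?Phi_gt0.
right; split; first by exists m.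
have [jm Jm] := Jfin _ (lt_trans Jmd xdag_finite).
move: Jmd; rewrite Jm Jd lte_fin => jmd.
set s := `|A m - y|; set d := jd - jm.
have d_gt0 : 0 < d by rewrite subr_gt0.
have s1_gt0 : 0 < s ^+ 2 + 1 by rewrite ltr_wpDl ?sqr_ge0.
(* The first bound keeps [j - jm] above [d / 2]; the second makes [2 * e * s ^+ 2] strictly smaller
   than [(d / 2) ^+ 2], even when [s = 0]. *)
pose e := Num.min (d / 2) (d ^+ 2 / 8 / (s ^+ 2 + 1)).
have e_gt0 : 0 < e by rewrite lt_min !divr_gt0 ?exprn_gt0.
move=> /superlinear_small /(_ e_gt0)[a [a_gt0 Psi_lt Psi_lta]].
have [j [Jj le_jd]] := residual _ a_gt0.
have := Psi_bound _ a_gt0; rewrite Jj Jd -EFinB lee_fin => jdj.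
have := tikhonov_optimality a_gt0 (xa_min _ a_gt0) J_convex Jj Jm.
rewrite -/s; set r := `|A (xa a) - y| in le_jd * => le_rs.
have e_d : e <= d / 2 by rewrite ge_min lexx.
have e_s : e * (s ^+ 2 + 1) <= d ^+ 2 / 8.
  by rewrite -ler_pdivlMr// ge_min lexx orbT.
have ad_le : a * (d / 2) <= r * s.
  apply: le_trans le_rs; rewrite ler_pM2l//.
  by move: e_d Psi_lt jdj; rewrite /d; lra.
(* The residual inequality gives [r ^+ 2 <= 2 * a * (jd - j)], and [jd - j <= Psi a < e * a]. *)
have r2_le : r ^+ 2 <= 2 * (a * (e * a)).
  have : a * (jd - j) <= a * (e * a) by rewrite ler_pM2l// (le_trans jdj)// ltW.
  by move: le_jd; lra.
have sq_le : (a * (d / 2)) ^+ 2 <= (r * s) ^+ 2.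
  by rewrite lerXn2r ?nnegrE ?mulr_ge0 ?invr_ge0 ?(ltW a_gt0) ?(ltW d_gt0) ?normr_ge0.
have rs2_le : (r * s) ^+ 2 <= a ^+ 2 * (2 * (e * s ^+ 2)).
  have -> : a ^+ 2 * (2 * (e * s ^+ 2)) = 2 * (a * (e * a)) * s ^+ 2 by ring.
  by rewrite exprMn ler_wpM2r ?sqr_ge0.
(* Cancelling [a ^+ 2] leaves [(d / 2) ^+ 2 <= 2 * e * s ^+ 2], against the choice of [e]. *)
have := le_trans sq_le rs2_le; rewrite exprMn ler_pM2l ?exprn_gt0// => dd.
by move: e_s e_gt0 dd; lra.
Qed.
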